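(* Let $d,N\ge1$ be integers and let $\mu$ be a Borel probability measure on $(\mathbb{R}^d)^N$. Then for every $\varepsilon>0$ and every $j=1,\dots,N$: (i) the $j$-th marginal of $\Lambda^\varepsilon[\mu]$ is $\mu_j*\eta^\varepsilon$; (ii) the $j$-th marginal of $\Theta^\varepsilon[\mu]$ is $\mu_j$.
   Context: For a probability measure $\nu$ on $(\mathbb{R}^d)^N$, its $j$-th marginal is $\nu_j=\pi^j_\#\nu$, where $\pi^j(x_1,\dots,x_N)=x_j$. For $\varepsilon>0$ let $\eta^\varepsilon(z)=(2\pi\varepsilon)^{-d/2}\exp(-|z|^2/(2\varepsilon))$ for $z\in\mathbb{R}^d$ (Euclidean norm). $\Lambda^\varepsilon[\mu]$ is the probability measure on $(\mathbb{R}^d)^N$ with Lebesgue density $\Lambda^\varepsilon[\mu](Y)=\int\prod_{k=1}^N\eta^\varepsilon(y_k-x_k)\,d\mu(X)$. $\mu_k*\eta^\varepsilon$ is the probability measure on $\mathbb{R}^d$ with density $(\mu_k*\eta^\varepsilon)(y)=\int\eta^\varepsilon(y-x)\,d\mu_k(x)$. The measure $\Theta^\varepsilon[\mu]$ on $(\mathbb{R}^d)^N$ is defined by $$\int\psi\,d\Theta^\varepsilon[\mu]=\iint\psi(X)\prod_{k=1}^N\left(\frac{\eta^\varepsilon(y_k-x_k)}{(\mu_k*\eta^\varepsilon)(y_k)}\,d\mu_k(x_k)\right)d\Lambda^\varepsilon[\mu](Y)\quad\text{for all }\psi\in C_b((\mathbb{R}^d)^N).$$ *)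

(* Defs.v *)
From HB Require Import structures.
From mathcomp Require Import all_boot all_order all_algebra.
From mathcomp Require Import all_classical all_reals all_analysis.
From mathcomp Require Import measurable_realfun.

Set Implicit Arguments.
Unset Strict Implicit.
Unset Printing Implicit Defensive.

Import Order.TTheory GRing.Theory Num.Theory.
Import numFieldNormedType.Exports.

Local Open Scope classical_set_scope.
Local Open Scope ring_scope.

(* R^d is [d.-tuple R] and (R^d)^N is [N.-tuple (d.-tuple R)], both with the
   product sigma-algebra of the library, which coincides with the Borel
   sigma-algebra since R is second countable. *)

Section product_measure_tuple.
Context d (T : measurableType d) (R : realType).

Section cons.
Variables (n : nat) (m1 : {sigma_finite_measure set T -> \bar R})
  (m2 : {sigma_finite_measure set (n.-tuple T) -> \bar R}).

Definition tcons (x : T * n.-tuple T) : n.+1.-tuple T := [tuple of x.1 :: x.2].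

Lemma measurable_tcons : measurable_fun setT tcons.
Proof. exact: measurable_cons. Qed.

Definition tuple_product_cons : set (n.+1.-tuple T) -> \bar R :=
  pushforward (m1 \x m2)%E tcons.

Let product_cons0 : tuple_product_cons set0 = 0%E.
Proof. by rewrite /tuple_product_cons /pushforward preimage_set0 measure0. Qed.

Let product_cons_ge0 A : (0 <= tuple_product_cons A)%E.
Proof. by rewrite /tuple_product_cons /pushforward; exact: measure_ge0. Qed.

Let product_cons_sigma_additive : semi_sigma_additive tuple_product_cons.
Proof.
have mp A : measurable A -> measurable (tcons @^-1` A).
  by move=> mA; rewrite -[X in measurable X]setTI; exact: measurable_tcons.
move=> F mF tF mUF; rewrite /tuple_product_cons /pushforward preimage_bigcup.
apply: measure_semi_sigma_additive.
- by move=> k; exact: mp.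
- apply/trivIsetP => /= i j _ _ ij; rewrite -preimage_setI.
  by move/trivIsetP : tF => /(_ _ _ _ _ ij) ->//; rewrite preimage_set0.
- by rewrite -preimage_bigcup; exact: mp.
Qed.

HB.instance Definition _ := isMeasure.Build _ _ _ tuple_product_cons
  product_cons0 product_cons_ge0 product_cons_sigma_additive.

Let product_cons_sigma_finite : sigma_finite setT tuple_product_cons.
Proof.
have /sigma_finiteP[F [TF ndF Foo]] := sigma_finiteT m1.
have /sigma_finiteP[G [TG ndG Goo]] := sigma_finiteT m2.
exists (fun k => [set x : n.+1.-tuple T | F k (thead x) /\
                                          G k [tuple of behead x]]).
  rewrite predeqE => x; split => // _.
  have [k _ Fk] : (\bigcup_k F k) (thead x) by rewrite -TF.
  have [l _ Gl] : (\bigcup_k G k) [tuple of behead x] by rewrite -TG.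
  exists (maxn k l) => //; split.
  - by move: Fk; exact/subsetPset/ndF/leq_maxl.
  - by move: Gl; exact/subsetPset/ndG/leq_maxr.
move=> k; have [mF Fk] := Foo k; have [mG Gk] := Goo k; split.
  apply: measurableI.
  - by rewrite -[X in measurable X]setTI; exact: (measurable_tnth ord0).
  - by rewrite -[X in measurable X]setTI; exact: measurable_behead.
have bK x (t : n.-tuple T) : [tuple of behead (tcons (x, t))] = t.
  exact/val_inj.
rewrite /tuple_product_cons /pushforward (_ : _ @^-1` _ = F k `*` G k).
  by rewrite product_measure1E// lte_mul_pinfty// ge0_fin_numE.
by apply/seteqP; split => -[x t] /=; rewrite theadE bK.
Qed.

HB.instance Definition _ := Measure_isSigmaFinite.Build _ _ _
  tuple_product_cons product_cons_sigma_finite.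

End cons.

(* m 0 (x) ... (x) m (n - 1); the empty product is the unit mass. *)
Fixpoint tuple_product n : ('I_n -> {sigma_finite_measure set T -> \bar R}) ->
    {sigma_finite_measure set (n.-tuple T) -> \bar R} :=
  match n with
  | 0 => fun _ => dirac ([tuple] : 0.-tuple T)
  | n'.+1 => fun m =>
      tuple_product_cons (m ord0) (tuple_product (fun i => m (lift ord0 i)))
  end.

End product_measure_tuple.

Section density.
Local Open Scope ereal_scope.
Context d (T : measurableType d) (R : realType).
Variables (m : {measure set T -> \bar R}) (f : T -> R).
Hypotheses (mf : measurable_fun setT f) (f0 : forall x, (0 <= f x)%R).

Definition with_density (A : set T) : \bar R := \int[m]_(x in A) (f x)%:E.

Lemma with_density0 : with_density set0 = 0.
Proof. exact: integral_set0. Qed.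

Lemma with_density_ge0 A : 0 <= with_density A.
Proof. by apply: integral_ge0 => x _; rewrite lee_fin. Qed.

Lemma with_density_sigma_additive : semi_sigma_additive with_density.
Proof.
move=> F mF tF mUF.
have mfF : measurable_fun (\bigcup_k F k) (EFin \o f).
  by apply/measurable_EFinP; exact: measurable_funTS.
rewrite /with_density ge0_integral_bigcup//.
- by apply: is_cvg_ereal_nneg_natsum => k _; exact: with_density_ge0.
- by move=> x _; rewrite lee_fin.
Qed.

End density.

Section lebesgue.
Variable R : realType.

(* [lebesgue_measure] lives on [measurableTypeR R]; here it is viewed on [R]
   with its canonical measurable structure (the same sigma-algebra). *)
Definition lebesgue_R : set R -> \bar R := @lebesgue_measure R.

HB.instance Definition _ := isMeasure.Build _ _ _ lebesgue_R
  (measure0 (@lebesgue_measure R)) (measure_ge0 (@lebesgue_measure R))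
  (@measure_semi_sigma_additive _ _ _ (@lebesgue_measure R)).

HB.instance Definition _ := Measure_isSigmaFinite.Build _ _ _ lebesgue_R
  (sigma_finiteT (@lebesgue_measure R)).

Definition lebesgue_Rd d : {sigma_finite_measure set (d.-tuple R) -> \bar R} :=
  tuple_product (fun _ : 'I_d => lebesgue_R).

Definition lebesgue_RdN N d :
    {sigma_finite_measure set (N.-tuple (d.-tuple R)) -> \bar R} :=
  tuple_product (fun _ : 'I_N => lebesgue_Rd d).

End lebesgue.

Section regularization.
Context (R : realType) (d N : nat).

Local Notation Rd := (d.-tuple R).
Local Notation RdN := (N.-tuple (d.-tuple R)).

Definition gauss (eps : R) (z : Rd) : R :=
  (2 * pi * eps) `^ (- (d%:R / 2)) *
  expR (- (\sum_(i < d) tnth z i ^+ 2) / (2 * eps)).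

Definition tsub (y x : Rd) : Rd := [tuple tnth y i - tnth x i | i < d].

Lemma gauss_ge0 eps z : 0 <= gauss eps z.
Proof. by rewrite mulr_ge0 ?powR_ge0 ?expR_ge0. Qed.

Lemma measurable_gauss eps : measurable_fun setT (gauss eps).
Proof.
apply: measurable_funM => //; apply: measurableT_comp => //.
apply: measurable_funM => //; apply: measurableT_comp => //.
apply: measurable_sum => i; apply: measurable_funX; exact: measurable_tnth.
Qed.

Lemma measurable_tsub : measurable_fun setT (fun p : Rd * Rd => tsub p.1 p.2).
Proof.
apply/measurable_fun_tnthP => i /=.
rewrite (_ : _ \o _ = fun p : Rd * Rd => tnth p.1 i - tnth p.2 i); last first.
  by apply/funext => p /=; rewrite tnth_mktuple.
apply: measurable_funB; apply: (measurableT_comp (measurable_tnth i)) => //.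
Qed.

Section marginal.
Variable j : 'I_N.

Definition marginal (nu : set RdN -> \bar R) : set Rd -> \bar R :=
  pushforward nu (fun X : RdN => tnth X j).

Let marginal0 (nu : {measure set RdN -> \bar R}) : marginal nu set0 = 0%E.
Proof. by rewrite /marginal /pushforward preimage_set0 measure0. Qed.

Let marginal_ge0 (nu : {measure set RdN -> \bar R}) A :
  (0 <= marginal nu A)%E.
Proof. by rewrite /marginal /pushforward; exact: measure_ge0. Qed.

Let marginal_sigma_additive (nu : {measure set RdN -> \bar R}) :
  semi_sigma_additive (marginal nu).
Proof.
have mp A : measurable A -> measurable ((fun X : RdN => tnth X j) @^-1` A).
  by move=> mA; rewrite -[X in measurable X]setTI; exact: measurable_tnth.
move=> F mF tF mUF; rewrite /marginal /pushforward preimage_bigcup.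
apply: measure_semi_sigma_additive.
- by move=> k; exact: mp.
- apply/trivIsetP => /= k l _ _ kl; rewrite -preimage_setI.
  by move/trivIsetP : tF => /(_ _ _ _ _ kl) ->//; rewrite preimage_set0.
- by rewrite -preimage_bigcup; exact: mp.
Qed.

HB.instance Definition _ (nu : {measure set RdN -> \bar R}) :=
  isMeasure.Build _ _ _ (marginal nu)
    (marginal0 nu) (marginal_ge0 nu) (@marginal_sigma_additive nu).

Let marginal_setT (nu : probability RdN R) : marginal nu setT = 1%E.
Proof. by rewrite /marginal /pushforward preimage_setT probability_setT. Qed.

HB.instance Definition _ (nu : probability RdN R) :=
  Measure_isProbability.Build _ _ _ (marginal nu) (marginal_setT nu).

End marginal.

Section convolution.
Variables (eps : R) (nu : probability Rd R).

Definition conv_density (y : Rd) : R := (\int[nu]_x gauss eps (tsub y x))%R.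

Lemma conv_density_ge0 y : 0 <= conv_density y.
Proof. by apply: Rintegral_ge0 => x _; exact: gauss_ge0. Qed.

Lemma measurable_conv_density : measurable_fun setT conv_density.
Proof.
apply: (measurableT_comp (fine_measurable measurableT)).
apply: (@measurable_fun_fubini_tonelli_F _ _ _ _ _ nu
  (fun p : Rd * Rd => (gauss eps (tsub p.1 p.2))%:E)).
- apply/measurable_EFinP; apply: (measurableT_comp (measurable_gauss eps)).
  exact: measurable_tsub.
- by move=> p; rewrite lee_fin gauss_ge0.
Qed.

Definition gauss_conv : set Rd -> \bar R :=
  with_density (lebesgue_Rd R d) conv_density.

HB.instance Definition _ := isMeasure.Build _ _ _ gauss_conv
  (with_density0 _ _) (with_density_ge0 _ conv_density_ge0)
  (@with_density_sigma_additive _ _ _ _ _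
    measurable_conv_density conv_density_ge0).

End convolution.

Section Lambda.
Variables (eps : R) (mu : probability RdN R).

Definition Lambda_density (Y : RdN) : R :=
  (\int[mu]_X \prod_(k < N) gauss eps (tsub (tnth Y k) (tnth X k)))%R.

Lemma Lambda_density_ge0 Y : 0 <= Lambda_density Y.
Proof.
by apply: Rintegral_ge0 => X _; apply: prodr_ge0 => k _; exact: gauss_ge0.
Qed.

Lemma measurable_Lambda_density : measurable_fun setT Lambda_density.
Proof.
apply: (measurableT_comp (fine_measurable measurableT)).
apply: (@measurable_fun_fubini_tonelli_F _ _ _ _ _ mu (fun p : RdN * RdN =>
  (\prod_(k < N) gauss eps (tsub (tnth p.1 k) (tnth p.2 k)))%:E)).
- apply/measurable_EFinP; apply: measurable_prod => k _.
  have mk : measurable_fun setT (fun p : RdN * RdN => (tnth p.1 k, tnth p.2 k)).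
    by apply: measurable_fun_pair; apply: (measurableT_comp (measurable_tnth k)).
  exact: (measurableT_comp (measurable_gauss eps)
    (measurableT_comp measurable_tsub mk)).
- by move=> p; rewrite lee_fin; apply: prodr_ge0 => k _; exact: gauss_ge0.
Qed.

Definition Lambda : set RdN -> \bar R :=
  with_density (lebesgue_RdN R N d) Lambda_density.

HB.instance Definition _ := isMeasure.Build _ _ _ Lambda
  (with_density0 _ _) (with_density_ge0 _ Lambda_density_ge0)
  (@with_density_sigma_additive _ _ _ _ _
    measurable_Lambda_density Lambda_density_ge0).

End Lambda.

(* Continuity is with respect to the library topology of 'M[R]_(N, d), to
   which (R^d)^N is homeomorphic; tuples carry no topology of their own. *)
Definition tuple_of_mx (M : 'M[R]_(N, d)) : RdN :=
  [tuple [tuple M k i | i < d] | k < N].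

Definition Cb (psi : RdN -> R) : Prop :=
  continuous (psi \o tuple_of_mx) /\
  exists C : R, forall X, `|psi X| <= C.

Definition is_Theta (eps : R) (mu : probability RdN R)
    (nu : {measure set RdN -> \bar R}) : Prop :=
  (forall psi : RdN -> R, Cb psi ->
    \int[nu]_X (psi X)%:E =
    \int[Lambda eps mu]_Y
      (\int[tuple_product (fun k : 'I_N => marginal k mu)]_X
        (psi X * \prod_(k < N)
          (gauss eps (tsub (tnth Y k) (tnth X k)) /
           conv_density eps (marginal k mu) (tnth Y k)))%:E))%E.

(* Finite Borel measures on (R^d)^N agreeing on C_b are equal, so this is the
   measure specified by [is_Theta]. The null measure is a junk value, reached
   only if no measure satisfied the specification. *)
Definition Theta (eps : R) (mu : probability RdN R) :
    {measure set RdN -> \bar R} :=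
  if pselect (exists nu, is_Theta eps mu nu) is left ex
  then sval (cid ex) else mzero.

End regularization.

(* Main.v *)
From HB Require Import structures.
Require Import Defs.
From mathcomp Require Import all_boot all_order all_algebra.
From mathcomp Require Import all_classical all_reals all_analysis.
From mathcomp Require Import measurable_realfun.

(** The Gaussian kernel integrates to 1 in its first variable, and a product
measure integrates a product of one-variable functions factor by factor.
These two facts carry both computations of marginals.

For the regularization, integrate a nonnegative function of [y_j] against
[Lambda]. Tonelli moves the integral over [mu] outside; for fixed [X] the
factors with [k != j] each integrate to 1, so only the [j]-th Gaussian
survives, and what remains is the integral against the convolution of the
[j]-th marginal ([integral_Lambda_marginal]).

For [Theta], the quotient [gauss (y - x) / conv_density y], as a function of
[x], is the density with respect to [mu_k] of the conditional law of the point
[x] given its noisy observation [y]; this posterior hence has mass 1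
([integral_posterior]). A test function of [x_j] thus only sees the [j]-th
posterior; the outer integral becomes one against the [j]-th marginal of
[Lambda], that is, against the convolution, whose density cancels the
denominator of the posterior. Integrating the Gaussian in [y] then leaves the
integral against [mu_j] ([integral_posterior_gauss_conv],
[is_Theta_integral_marginal]).

Two points of measure theory remain. The measure [Theta] is only specified
through its integrals of bounded continuous functions, so it has to be shown
to exist: it is the law of [X] under the measure on pairs [(Y, X)] with
density [joint_posterior] with respect to [Lambda] times the product of the
marginals ([is_Theta_exists]). This uses that continuous functions are measurable for
the product sigma-algebra ([continuous_measurable_tuple]). Conversely the
bounded continuous test functions determine a finite measure
([finite_measure_eq_ramp]): open orthants form a generating pi-system, and
their indicators are increasing limits of continuous functions. *)

Set Implicit Arguments.
Unset Strict Implicit.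
Unset Printing Implicit Defensive.

Import Order.TTheory GRing.Theory Num.Theory.
Import numFieldNormedType.Exports.

Local Open Scope classical_set_scope.
Local Open Scope ring_scope.

(** * Integration against a measure with a density *)

Section density.
Local Open Scope ereal_scope.
Context d (T : measurableType d) (R : realType).
Variables (m : {measure set T -> \bar R}) (g : T -> R).
Hypotheses (mg : measurable_fun setT g) (g0 : forall x, (0 <= g x)%R).
(** A measure is represented by [mw] rather than by [with_density m g] itself,
so that the lemmas apply to any measure structure carried by that function. *)
Variable mw : {measure set T -> \bar R}.
Hypothesis mwE : forall A, measurable A -> mw A = with_density m g A.

Import HBNNSimple.

(** Both sides are limits along simple functions approximating [f], and for an
indicator the equality is the definition of the density measure. *)
Lemma ge0_integral_density (f : T -> \bar R) :
  measurable_fun setT f -> (forall x, 0 <= f x) ->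
  \int[mw]_x f x = \int[m]_x (f x * (g x)%:E).
Proof.
move=> mf f0; pose h := nnsfun_approx measurableT mf.
have h0 n x : 0 <= (h n x)%:E * (g x)%:E by rewrite mule_ge0 ?lee_fin.
have mgE : measurable_fun setT (EFin \o g) by exact/measurable_EFinP.
transitivity (limn (fun n => \int[mw]_x (h n x)%:E)).
  rewrite -monotone_convergence//.
  - apply: eq_integral => x _; apply/esym/cvg_lim => //.
    exact: cvg_nnsfun_approx.
  - by move=> n; exact/measurable_EFinP/measurable_funP.
  - by move=> n y _; rewrite lee_fin.
  - by move=> y _ a b ab; rewrite lee_fin; exact/lefP/nd_nnsfun_approx.
transitivity (limn (fun n => \int[m]_x ((h n x)%:E * (g x)%:E))); last first.
  rewrite -monotone_convergence//.
  - apply: eq_integral => x _; apply/cvg_lim => //.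
    by apply: cvgeZr => //; exact: cvg_nnsfun_approx.
  - move=> n; apply: emeasurable_funM => //.
    exact/measurable_EFinP/measurable_funP.
  - by move=> y _ a b ab; rewrite lee_wpmul2r ?lee_fin//;
      exact/lefP/nd_nnsfun_approx.
congr (limn _); apply/funext => n.
under eq_integral do rewrite fimfunE -fsumEFin//.
rewrite ge0_integral_fsum//; last 2 first.
- by move=> y; apply/measurable_EFinP/measurable_funM.
- by move=> y x _; rewrite nnfun_muleindic_ge0.
under [RHS]eq_integral => x _.
  rewrite fimfunE -fsumEFin// ge0_mule_fsuml; last first.
    by move=> y; exact: nnfun_muleindic_ge0.
  over.
rewrite [RHS]ge0_integral_fsum//; last 2 first.
- by move=> y; apply: emeasurable_funM => //;
    exact/measurable_EFinP/measurable_funM.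
- by move=> y x _; rewrite mule_ge0 ?lee_fin// ; exact: nnfun_muleindic_ge0.
apply: eq_fsbigr => r _.
have [r0|r0] := ltP r 0%R.
  rewrite !integral0_eq// => x _;
    by rewrite preimage_nnfun0// indic0/= mulr0 ?mul0e.
under eq_integral do rewrite EFinM.
rewrite ge0_integralZl//; last exact/measurable_EFinP/measurable_indic.
rewrite integral_indic// setIT mwE// /with_density integral_mkcond.
under [RHS]eq_integral do rewrite EFinM -muleA.
rewrite [RHS]ge0_integralZl//; last 2 first.
- by apply: emeasurable_funM => //; exact/measurable_EFinP/measurable_indic.
- by move=> x _; rewrite mule_ge0 ?lee_fin.
congr (_ * _); apply: eq_integral => x _.
by rewrite patchE indicE; case: ifPn => _; rewrite ?mul1e ?mul0e.
Qed.

(** As [g] is nonnegative, multiplying by it commutes with taking positive and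
negative parts. *)
Lemma integral_density (f : T -> \bar R) : measurable_fun setT f ->
  \int[mw]_x f x = \int[m]_x (f x * (g x)%:E).
Proof.
move=> mf; rewrite integralE [RHS]integralE.
rewrite !ge0_integral_density; first last.
- by move=> x; exact: funepos_ge0.
- exact: measurable_funepos.
- by move=> x; exact: funeneg_ge0.
- exact: measurable_funeneg.
congr (_ - _); apply: eq_integral => x _.
  by rewrite !funeposE maxe_pMl ?lee_fin// mul0e.
by rewrite !funenegE maxe_pMl ?lee_fin// mul0e mulNe.
Qed.

End density.

(** * Products of functions against product measures *)

Section tuple_product.
Context d (T : measurableType d) (R : realType).

Lemma ge0_integral_tuple_product_prod n
    (m : 'I_n -> {sigma_finite_measure set T -> \bar R}) (f : 'I_n -> T -> R) :
  (forall k, measurable_fun setT (f k)) -> (forall k x, 0 <= f k x) ->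
  (\int[tuple_product m]_X (\prod_(k < n) f k (tnth X k))%:E =
   \prod_(k < n) \int[m k]_x (f k x)%:E)%E.
Proof.
elim: n m f => [|n IH] m f mf f0.
  under eq_integral do rewrite big_ord0.
  by rewrite big_ord0 integral_dirac//= diracT mul1e.
have mtl : measurable_fun setT (fun X : n.-tuple T =>
    (\prod_(k < n) f (lift ord0 k) (tnth X k))%R).
  by apply: measurable_prod => k _; apply: (measurableT_comp (mf _));
    exact: measurable_tnth.
rewrite /= (@ge0_integral_pushforward _ _ _ _ _ _ (@measurable_tcons _ _ _)
  (m ord0 \x tuple_product (fun i => m (lift ord0 i)))%E)//=; last 2 first.
- apply/measurable_EFinP; apply: measurable_prod => k _.
  by apply: (measurableT_comp (mf _)); exact: measurable_tnth.
- by move=> X _; rewrite lee_fin; apply: prodr_ge0.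
rewrite preimage_setT.
rewrite (@eq_integral _ _ _ _ _ (fun p : T * n.-tuple T => (f ord0 p.1 *
  \prod_(i < n) f (lift ord0 i) (tnth p.2 i))%:E)); last first.
  move=> [x X] _ /=; rewrite big_ord_recl tnth0; congr (_ * _)%:E.
  by apply: eq_bigr => i _; rewrite tnthS.
rewrite (fubini_tonelli1 (fun p : T * n.-tuple T => (f ord0 p.1 *
  \prod_(i < n) f (lift ord0 i) (tnth p.2 i))%:E))//=; last 2 first.
- apply/measurable_EFinP; apply: measurable_funM.
    exact: (measurableT_comp (mf _)).
  exact: (measurableT_comp mtl).
- by move=> p; rewrite lee_fin mulr_ge0// prodr_ge0.
rewrite /fubini_F/= big_ord_recl -IH//.
rewrite -ge0_integralZr//; last 3 first.
- exact/measurable_EFinP.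
- by move=> x _; rewrite lee_fin.
- by apply: integral_ge0 => X _; rewrite lee_fin prodr_ge0.
apply: eq_integral => x _; rewrite -ge0_integralZl//; last 3 first.
- exact/measurable_EFinP.
- by move=> X _; rewrite lee_fin prodr_ge0.
- by rewrite lee_fin.
Qed.

(** Factors of mass 1 integrate out: this is how every coordinate other than
the [j]-th disappears from the marginals below. *)
Lemma ge0_integral_tuple_product_marginal n
    (m : 'I_n -> {sigma_finite_measure set T -> \bar R}) (g : 'I_n -> T -> R)
    (f : T -> R) (j : 'I_n) :
  (forall k, measurable_fun setT (g k)) -> (forall k x, 0 <= g k x) ->
  (forall k, \int[m k]_x (g k x)%:E = 1)%E ->
  measurable_fun setT f -> (forall x, 0 <= f x) ->
  (\int[tuple_product m]_X (f (tnth X j) * \prod_(k < n) g k (tnth X k))%:E =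
   \int[m j]_x (f x * g j x)%:E)%E.
Proof.
move=> mg g0 g1 mf f0.
pose h k x := if k == j then f x * g k x else g k x.
rewrite (@eq_integral _ _ _ _ _
  (fun X : n.-tuple T => (\prod_(k < n) h k (tnth X k))%:E)); last first.
  move=> X _; congr EFin; rewrite (bigD1 j)//= [RHS](bigD1 j)//=.
  rewrite mulrA {1}/h eqxx.
  by congr (_ * _); apply: eq_bigr => k /negPf kj; rewrite /h kj.
rewrite ge0_integral_tuple_product_prod; last 2 first.
- by move=> k; rewrite /h; case: (k == j) => //; exact: measurable_funM.
- by move=> k x; rewrite /h; case: ifP => // _; rewrite mulr_ge0.
rewrite (bigD1 j)//= big1 ?mule1.
  by apply: eq_integral => x _; rewrite /h eqxx.
by move=> k /negPf kj; rewrite /h kj.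
Qed.

End tuple_product.

(** * The Gaussian kernel *)

(** [R] and [measurableTypeR R] carry the same measurable sets but are distinct
structures; the integral is carried over by pushing forward along the
identity. *)
Lemma ge0_integral_lebesgue_R (R : realType) (f : R -> \bar R) :
  measurable_fun setT f -> (forall x, 0 <= f x)%E ->
  (\int[lebesgue_R (R := R)]_x f x = \int[lebesgue_measure]_x f x)%E.
Proof.
move=> mf f0.
have mid : measurable_fun [set: measurableTypeR R] (fun x => x : R).
  by move=> _ B mB; rewrite setTI preimage_id.
rewrite (eq_measure_integral (pushforward lebesgue_measure
  ((fun x => x) : measurableTypeR R -> R)))//.
by rewrite ge0_integral_pushforward//.
Qed.

Section gauss.
Context (R : realType) (d : nat) (eps : R) (heps : 0 < eps).
Implicit Types x y : d.-tuple R.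

(** The Gaussian on [R^d] centred at [x] is the product of one-dimensional
normal densities, which reduces its mass to the one-dimensional integral. *)
Lemma gauss_tsubE y x : gauss eps (tsub y x) =
  \prod_(i < d) normal_pdf (tnth x i) (Num.sqrt eps) (tnth y i).
Proof.
have s0 : Num.sqrt eps != 0 by rewrite gt_eqF// sqrtr_gt0.
have e0 := ltW heps.
under eq_bigr do rewrite normal_pdfE// /normal_peak /normal_fun sqr_sqrtr//.
rewrite big_split/= prodr_const card_ord -expR_sum /gauss; congr (_ * expR _).
  rewrite powRN [d%:R / 2]mulrC powRrM powR12_sqrt; last first.
    by rewrite !mulr_ge0 ?pi_ge0.
  rewrite powR_mulrn ?sqrtr_ge0// exprVn; congr ((Num.sqrt _ ^+ _)^-1).
  by rewrite -[RHS]mulr_natl -mulrA [pi * _]mulrC.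
rewrite mulNr mulr_suml -sumrN; apply: eq_bigr => i _.
by rewrite tnth_mktuple mulNr [2 * eps]mulr_natl.
Qed.

Lemma gauss_gt0 (z : d.-tuple R) : 0 < gauss eps z.
Proof. by rewrite mulr_gt0 ?expR_gt0// powR_gt0// !mulr_gt0 ?pi_gt0. Qed.

Lemma gauss_le (z : d.-tuple R) :
  gauss eps z <= (2 * pi * eps) `^ (- (d%:R / 2)).
Proof.
rewrite ler_piMr ?powR_ge0// -expR0 ler_expR mulNr oppr_le0 divr_ge0//.
  by apply: sumr_ge0 => i _; rewrite sqr_ge0.
by rewrite mulr_ge0// ltW.
Qed.

Lemma integral_gauss_tsub x :
  (\int[lebesgue_Rd R d]_y (gauss eps (tsub y x))%:E = 1)%E.
Proof.
under eq_integral do rewrite gauss_tsubE.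
rewrite (@ge0_integral_tuple_product_prod _ _ _ _ _
  (fun i => normal_pdf (tnth x i) (Num.sqrt eps))); last 2 first.
- by move=> k; exact: measurable_normal_pdf.
- by move=> k z; exact: normal_pdf_ge0.
rewrite big1// => i _; rewrite ge0_integral_lebesgue_R ?integral_normal_pdf//.
  by apply/measurable_EFinP; exact: measurable_normal_pdf.
by move=> z; rewrite lee_fin normal_pdf_ge0.
Qed.

End gauss.

(** * Bounded functions against a probability measure *)

Section bounded_integral.
Context d (T : measurableType d) (R : realType) (P : probability T R).

Lemma ge0_integral_bounded (f : T -> R) (C : R) :
  measurable_fun setT f -> (forall x, 0 <= f x <= C) ->
  (\int[P]_x (f x)%:E <= C%:E)%E.
Proof.
move=> mf fC; apply: (@le_trans _ _ (\int[P]_x (cst C%:E x))%E).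
  apply: ge0_le_integral => //.
  - by move=> x _; rewrite lee_fin; case/andP: (fC x).
  - exact/measurable_EFinP.
  - by move=> x _; rewrite lee_fin; case/andP: (fC x).
by rewrite integral_cst//= probability_setT mule1.
Qed.

(** The densities are real-valued integrals, whereas Tonelli applies to
extended ones; boundedness of the Gaussian makes them agree. *)
Lemma EFin_Rintegral_bounded (f : T -> R) (C : R) :
  measurable_fun setT f -> (forall x, 0 <= f x <= C) ->
  (\int[P]_x f x)%:E = (\int[P]_x (f x)%:E)%E.
Proof.
move=> mf fC; rewrite /Rintegral fineK// ge0_fin_numE.
  by rewrite (le_lt_trans (ge0_integral_bounded mf fC))// ltry.
by apply: integral_ge0 => x _; rewrite lee_fin; case/andP: (fC x).
Qed.

End bounded_integral.

(** * Convolution with the Gaussian *)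

Section gauss_measurability.
Context (R : realType) (d : nat) (eps : R).

Lemma measurable_gauss_tsub : measurable_fun setT
  (fun p : d.-tuple R * d.-tuple R => gauss eps (tsub p.1 p.2)).
Proof.
exact: (measurableT_comp (measurable_gauss eps) (@measurable_tsub _ _)).
Qed.

Lemma measurable_gauss_tsubl x :
  measurable_fun setT (fun y : d.-tuple R => gauss eps (tsub y x)).
Proof.
exact: (measurableT_comp measurable_gauss_tsub (measurable_pair2 x)).
Qed.

Lemma measurable_gauss_tsubr y :
  measurable_fun setT (fun x : d.-tuple R => gauss eps (tsub y x)).
Proof.
exact: (measurableT_comp measurable_gauss_tsub (measurable_pair1 y)).
Qed.

End gauss_measurability.

Section convolution.
Context (R : realType) (d : nat) (eps : R) (heps : 0 < eps).
Variable nu : probability (d.-tuple R) R.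

Lemma EFin_conv_density y :
  (conv_density eps nu y)%:E = (\int[nu]_x (gauss eps (tsub y x))%:E)%E.
Proof.
apply: (@EFin_Rintegral_bounded _ _ _ _ _ ((2 * pi * eps) `^ (- (d%:R / 2)))).
  exact: measurable_gauss_tsubr.
by move=> x; rewrite gauss_ge0 gauss_le.
Qed.

(** The integral of a positive function against a probability measure cannot
vanish, since the function would then be 0 almost everywhere. *)
Lemma conv_density_gt0 y : 0 < conv_density eps nu y.
Proof.
rewrite lt0r conv_density_ge0 andbT; apply/eqP => c0.
have mg : measurable_fun setT (fun x => (gauss eps (tsub y x))%:E).
  by apply/measurable_EFinP; exact: measurable_gauss_tsubr.
have /ae_eq_integral_abs : (\int[nu]_x `|(gauss eps (tsub y x))%:E| = 0)%E.
  under eq_integral do rewrite gee0_abs ?lee_fin ?gauss_ge0//.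
  by rewrite -EFin_conv_density c0.
move=> /(_ measurableT mg) [A [mA A0 sA]].
suff : nu setT = 0%E by rewrite probability_setT => /eqP; rewrite onee_eq0.
apply: (subset_measure0 _ _ _ A0) => // x _; apply: sA => /= /(_ I) [] /eqP.
by rewrite gt_eqF// gauss_gt0.
Qed.

Lemma integral_gauss_conv (f : d.-tuple R -> R) :
  measurable_fun setT f -> (forall y, 0 <= f y) ->
  (\int[gauss_conv eps nu]_y (f y)%:E =
   \int[nu]_x \int[lebesgue_Rd R d]_y (f y * gauss eps (tsub y x))%:E)%E.
Proof.
move=> mf f0; rewrite (ge0_integral_density (m := lebesgue_Rd R d)
  (mw := gauss_conv eps nu)
  (measurable_conv_density eps nu) (conv_density_ge0 eps nu)
  (fun _ _ => erefl)); last 2 first.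
- exact/measurable_EFinP.
- by move=> y; rewrite lee_fin.
pose h (p : d.-tuple R * d.-tuple R) := (f p.1 * gauss eps (tsub p.1 p.2))%:E.
rewrite -(fubini_tonelli (m1 := lebesgue_Rd R d) (m2 := nu) h); last 2 first.
- apply/measurable_EFinP; apply: measurable_funM.
    exact: (measurableT_comp mf).
  exact: measurable_gauss_tsub.
- by move=> p; rewrite lee_fin mulr_ge0// gauss_ge0.
apply: eq_integral => y _; rewrite EFin_conv_density -ge0_integralZl ?lee_fin//.
  by apply/measurable_EFinP; exact: measurable_gauss_tsubr.
by move=> x _; rewrite lee_fin gauss_ge0.
Qed.

End convolution.

(** * The regularized measure *)

Section Lambda.
Context (R : realType) (d N : nat) (eps : R) (heps : 0 < eps).
Variable mu : probability (N.-tuple (d.-tuple R)) R.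
Local Notation Rd := (d.-tuple R).
Local Notation RdN := (N.-tuple (d.-tuple R)).

Lemma integral_marginal (nu : {measure set RdN -> \bar R}) (j : 'I_N)
    (f : Rd -> \bar R) :
  measurable_fun setT f -> (forall x, 0 <= f x)%E ->
  (\int[marginal j nu]_x f x = \int[nu]_X f (tnth X j))%E.
Proof.
move=> mf f0.
by rewrite (ge0_integral_pushforward (measurable_tnth j)).
Qed.

Lemma measurable_prod_gauss : measurable_fun setT (fun p : RdN * RdN =>
  \prod_(k < N) gauss eps (tsub (tnth p.1 k) (tnth p.2 k))).
Proof.
apply: measurable_prod => k _.
have mk : measurable_fun setT (fun p : RdN * RdN => (tnth p.1 k, tnth p.2 k)).
  by apply: measurable_fun_pair; apply: (measurableT_comp (measurable_tnth k)).
exact: (measurableT_comp (measurable_gauss_tsub eps) mk).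
Qed.

Lemma EFin_Lambda_density Y : (Lambda_density eps mu Y)%:E =
  (\int[mu]_X (\prod_(k < N) gauss eps (tsub (tnth Y k) (tnth X k)))%:E)%E.
Proof.
apply: (@EFin_Rintegral_bounded _ _ _ _ _
  (\prod_(k < N) (2 * pi * eps) `^ (- (d%:R / 2)))).
  exact: (measurableT_comp measurable_prod_gauss (measurable_pair1 Y)).
move=> X; rewrite prodr_ge0 => [|k _]; last exact: gauss_ge0.
by apply: ler_prod => k _; rewrite gauss_ge0 gauss_le.
Qed.

(** For fixed [X] the density is a product of Gaussians in the separate [y_k],
so after Tonelli every factor except the [j]-th integrates to 1. *)
Lemma integral_Lambda_marginal (j : 'I_N) (f : Rd -> R) :
  measurable_fun setT f -> (forall x, 0 <= f x) ->
  (\int[Lambda eps mu]_Y (f (tnth Y j))%:E =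
   \int[gauss_conv eps (marginal j mu)]_y (f y)%:E)%E.
Proof.
move=> mf f0; rewrite integral_gauss_conv// integral_marginal; last 2 first.
- pose h (p : Rd * Rd) := (f p.1 * gauss eps (tsub p.1 p.2))%:E.
  apply: (measurable_fun_fubini_tonelli_G (m1 := lebesgue_Rd R d) h).
    apply/measurable_EFinP; apply: measurable_funM.
      exact: (measurableT_comp mf).
    exact: measurable_gauss_tsub.
  by move=> p; rewrite lee_fin mulr_ge0// gauss_ge0.
- by move=> x; apply: integral_ge0 => y _; rewrite lee_fin mulr_ge0// gauss_ge0.
have mfj : measurable_fun setT (fun Y : RdN => f (tnth Y j)).
  exact: (measurableT_comp mf (measurable_tnth j)).
rewrite (ge0_integral_density (m := lebesgue_RdN R N d)
  (mw := Lambda eps mu)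
  (measurable_Lambda_density eps mu) (Lambda_density_ge0 eps mu)
  (fun _ _ => erefl)); last 2 first.
- exact/measurable_EFinP.
- by move=> y; rewrite lee_fin.
pose h (p : RdN * RdN) := (f (tnth p.1 j) *
  \prod_(k < N) gauss eps (tsub (tnth p.1 k) (tnth p.2 k)))%:E.
have hg (p : RdN * RdN) :
    0 <= \prod_(k < N) gauss eps (tsub (tnth p.1 k) (tnth p.2 k)).
  by apply: prodr_ge0 => k _; exact: gauss_ge0.
transitivity (\int[lebesgue_RdN R N d]_Y \int[mu]_X h (Y, X))%E.
  apply: eq_integral => Y _; rewrite EFin_Lambda_density.
  rewrite -ge0_integralZl ?lee_fin//.
    apply/measurable_EFinP.
    exact: (measurableT_comp measurable_prod_gauss (measurable_pair1 Y)).
  by move=> X _; rewrite lee_fin (hg (Y, X)).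
rewrite (fubini_tonelli (m1 := lebesgue_RdN R N d) (m2 := mu) h); last 2 first.
- apply/measurable_EFinP; apply: measurable_funM;
    last exact: measurable_prod_gauss.
  exact: (measurableT_comp mfj).
- by move=> p; rewrite lee_fin mulr_ge0.
apply: eq_integral => X _.
apply: (ge0_integral_tuple_product_marginal (m := fun=> lebesgue_Rd R d)
  (g := fun k y => gauss eps (tsub y (tnth X k)))) => //.
- by move=> k; exact: measurable_gauss_tsubl.
- by move=> k y; exact: gauss_ge0.
- by move=> k; exact: integral_gauss_tsub.
Qed.

Lemma marginal_Lambda (j : 'I_N) A : measurable A ->
  marginal j (Lambda eps mu) A = gauss_conv eps (marginal j mu) A.
Proof.
move=> mA; transitivity (\int[marginal j (Lambda eps mu)]_y (\1_A y)%:E)%E.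
  by rewrite integral_indic// setIT.
transitivity (\int[gauss_conv eps (marginal j mu)]_y (\1_A y)%:E)%E; last first.
  by rewrite integral_indic// setIT.
rewrite integral_marginal ?integral_Lambda_marginal//.
exact/measurable_EFinP/measurable_indic.
Qed.

Lemma Lambda_setT (j : 'I_N) : Lambda eps mu setT = 1%E.
Proof.
transitivity (\int[Lambda eps mu]_Y (cst 1%E Y))%E.
  by rewrite integral_cst// mul1e.
rewrite (@integral_Lambda_marginal j (cst 1%R))// integral_gauss_conv//.
transitivity (\int[marginal j mu]_x (cst 1%E x))%E.
  apply: eq_integral => x _; rewrite -[RHS](integral_gauss_tsub heps x).
  by apply: eq_integral => y _; rewrite mul1r.
by rewrite integral_cst//= mul1e probability_setT.
Qed.

End Lambda.

(** * Measurability of continuous functions of tuples *)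

Section continuous_measurable.
Context (R : realType) (d N : nat).
Local Notation RdN := (N.-tuple (d.-tuple R)).

(** Rounding every coordinate down to the grid of step [1 / (n + 1)]. A cell is
recorded by integers, so that there are only countably many of them. *)
Definition grid_cell (n : nat) (X : RdN) : 'M[int]_(N, d) :=
  \matrix_(k, i) Num.floor (n.+1%:R * tnth (tnth X k) i).

Definition grid_point (n : nat) (q : 'M[int]_(N, d)) : 'M[R]_(N, d) :=
  \matrix_(k, i) ((q k i)%:~R / n.+1%:R).

Lemma measurable_grid_cell n q : measurable [set X | grid_cell n X = q].
Proof.
rewrite (_ : [set X | _] = \bigcap_(p in [set: 'I_N * 'I_d])
  [set X : RdN | (q p.1 p.2)%:~R <= n.+1%:R * tnth (tnth X p.1) p.2
                                   < (q p.1 p.2 + 1)%:~R]); last first.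
  apply/seteqP; split => X /=.
    by move=> <- [k i] _ /=; rewrite mxE floor_itv.
  by move=> h; apply/matrixP => k i; rewrite mxE; exact/floor_def/(h (k, i)).
apply: fin_bigcap_measurable => // -[k i] _ /=.
have mh : measurable_fun setT (fun X : RdN => n.+1%:R * tnth (tnth X k) i).
  apply: measurable_funM => //.
  exact: (measurableT_comp (measurable_tnth i) (measurable_tnth k)).
have := mh measurableT _ (measurable_itv `[(q k i)%:~R, (q k i + 1)%:~R[).
by rewrite setTI; congr measurable; apply/seteqP; split => X /=; rewrite in_itv.
Qed.

Lemma grid_point_cvg (X : RdN) :
  grid_point n (grid_cell n X) @[n --> \oo] -->
  (\matrix_(k, i) tnth (tnth X k) i : 'M[R]_(N, d)).
Proof.
apply/cvg_ballP => e e0; near=> n; split => // k i; rewrite !mxE /ball/=.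
have n0 : 0 < n.+1%:R :> R by [].
have /andP[lex ltx] := floor_itv (n.+1%:R * tnth (tnth X k) i).
rewrite ger0_norm; last by rewrite subr_ge0 ler_pdivrMr// [leRHS]mulrC.
rewrite ltrBlDr; apply: (@lt_trans _ _
  ((Num.floor (n.+1%:R * tnth (tnth X k) i) + 1)%:~R / n.+1%:R)).
  by rewrite ltr_pdivlMr// [ltLHS]mulrC.
rewrite intrD mulrDl [e + _]addrC ltrD2l mul1r.
by near: n; exact: (near_infty_natSinv_lt (PosNum e0)).
Unshelve. all: by end_near. Qed.

(** A continuous function is the pointwise limit of its values at the rounded
points, and these take countably many values on measurable cells. *)
Lemma continuous_measurable_tuple (psi : RdN -> R) :
  continuous (psi \o @tuple_of_mx R d N) -> measurable_fun setT psi.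
Proof.
move=> cpsi.
pose phi n X := (psi \o @tuple_of_mx R d N) (grid_point n (grid_cell n X)).
apply: (@measurable_fun_cvg _ _ _ _ phi).
  move=> n _ B mB; rewrite setTI.
  rewrite (_ : _ @^-1` _ = \bigcup_(q in [set: 'M[int]_(N, d)])
    ([set X | grid_cell n X = q] `&`
     [set X | B ((psi \o @tuple_of_mx R d N) (grid_point n q))])); last first.
    apply/seteqP; split => X; first by move=> BX; exists (grid_cell n X).
    by move=> [q _ [/= <-]].
  apply: countable_bigcupT_measurable => // q.
  apply: measurableI; first exact: measurable_grid_cell.
  have [Bq|Bq] := pselect (B ((psi \o @tuple_of_mx R d N) (grid_point n q))).
    by rewrite (_ : [set _ | _] = setT)//; apply/seteqP; split.
  by rewrite (_ : [set _ | _] = set0)//; apply/seteqP; split.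
move=> X _; have -> : psi X =
    (psi \o @tuple_of_mx R d N) (\matrix_(k, i) tnth (tnth X k) i).
  rewrite /=; congr psi; apply/eq_from_tnth => k; rewrite tnth_mktuple.
  by apply/eq_from_tnth => i; rewrite tnth_mktuple mxE.
apply: continuous_cvg; first exact: cpsi.
exact: grid_point_cvg.
Qed.

End continuous_measurable.

(** * Conditional laws and existence of Theta *)

Section Theta.
Context (R : realType) (d N : nat) (eps : R) (heps : 0 < eps).
Variable mu : probability (N.-tuple (d.-tuple R)) R.
Local Notation Rd := (d.-tuple R).
Local Notation RdN := (N.-tuple (d.-tuple R)).

(** The density with respect to [nu] of the law of [x] drawn from [nu],
conditionally on the noisy observation [y] of [x]. *)
Definition posterior (nu : probability Rd R) (y x : Rd) : R :=
  gauss eps (tsub y x) / conv_density eps nu y.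

Lemma posterior_ge0 (nu : probability Rd R) y x : 0 <= posterior nu y x.
Proof. by rewrite divr_ge0 ?gauss_ge0 ?conv_density_ge0. Qed.

Lemma measurable_posterior (nu : probability Rd R) :
  measurable_fun setT (fun p : Rd * Rd => posterior nu p.1 p.2).
Proof.
apply: measurable_funM; first exact: measurable_gauss_tsub.
rewrite (_ : (fun _ => _) =
    (fun p : Rd * Rd => conv_density eps nu p.1 `^ (-1))); last first.
  by apply/funext => p; rewrite powR_inv1 ?conv_density_ge0.
apply: (measurableT_comp (measurable_powR _)).
exact: (measurableT_comp (measurable_conv_density eps nu)).
Qed.

Lemma measurable_posteriorr (nu : probability Rd R) y :
  measurable_fun setT (posterior nu y).
Proof.
exact: (measurableT_comp (measurable_posterior nu) (measurable_pair1 y)).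
Qed.

Lemma integral_posterior (nu : probability Rd R) y :
  (\int[nu]_x (posterior nu y x)%:E = 1)%E.
Proof.
under eq_integral do rewrite EFinM.
rewrite ge0_integralZr//.
- by rewrite -EFin_conv_density// -EFinM divff// gt_eqF// conv_density_gt0.
- by apply/measurable_EFinP; exact: measurable_gauss_tsubr.
- by move=> x _; rewrite lee_fin gauss_ge0.
- by rewrite lee_fin invr_ge0 conv_density_ge0.
Qed.

(** The law of total probability: averaging the conditional law of [x] over the
law of the observation gives back [nu]. The density of the observation cancels
the denominator of the posterior. *)
Lemma integral_posterior_gauss_conv (nu : probability Rd R) (f : Rd -> R) :
  measurable_fun setT f -> (forall x, 0 <= f x) ->
  (\int[gauss_conv eps nu]_y \int[nu]_x (f x * posterior nu y x)%:E =
   \int[nu]_x (f x)%:E)%E.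
Proof.
move=> mf f0.
pose h (p : Rd * Rd) := (f p.2 * posterior nu p.1 p.2)%:E.
have mh : measurable_fun setT h.
  apply/measurable_EFinP; apply: measurable_funM;
    last exact: measurable_posterior.
  exact: (measurableT_comp mf).
have h0 p : (0 <= h p)%E by rewrite lee_fin mulr_ge0 ?posterior_ge0.
rewrite (ge0_integral_density (m := lebesgue_Rd R d) (mw := gauss_conv eps nu)
  (measurable_conv_density eps nu) (conv_density_ge0 eps nu)
  (fun _ _ => erefl)); last 2 first.
- exact: (measurable_fun_fubini_tonelli_F (m2 := nu) h).
- by move=> y; apply: integral_ge0 => x _; exact: (h0 (y, x)).
pose g (p : Rd * Rd) := (f p.2 * gauss eps (tsub p.1 p.2))%:E.
transitivity (\int[lebesgue_Rd R d]_y \int[nu]_x g (y, x))%E.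
  apply: eq_integral => y _; rewrite -ge0_integralZr//.
  - apply: eq_integral => x _; rewrite -EFinM -mulrA divfK//.
    by rewrite gt_eqF// conv_density_gt0.
  - exact: (measurableT_comp mh (measurable_pair1 y)).
  - by move=> x _; exact: (h0 (y, x)).
  - by rewrite lee_fin conv_density_ge0.
rewrite (fubini_tonelli (m1 := lebesgue_Rd R d) (m2 := nu) g); last 2 first.
- apply/measurable_EFinP; apply: measurable_funM;
    last exact: measurable_gauss_tsub.
  exact: (measurableT_comp mf).
- by move=> p; rewrite lee_fin mulr_ge0// gauss_ge0.
apply: eq_integral => x _; rewrite -[RHS]mule1 -(integral_gauss_tsub heps x).
rewrite -ge0_integralZl ?lee_fin//.
  by apply/measurable_EFinP; exact: measurable_gauss_tsubl.
by move=> y _; rewrite lee_fin gauss_ge0.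
Qed.

Local Notation P := (tuple_product (fun k : 'I_N => marginal k mu)).

Definition joint_posterior (Y X : RdN) : R :=
  \prod_(k < N) posterior (marginal k mu) (tnth Y k) (tnth X k).

Lemma joint_posterior_ge0 Y X : 0 <= joint_posterior Y X.
Proof. by apply: prodr_ge0 => k _; exact: posterior_ge0. Qed.

Lemma measurable_joint_posterior :
  measurable_fun setT (fun p : RdN * RdN => joint_posterior p.1 p.2).
Proof.
apply: measurable_prod => k _.
have mk : measurable_fun setT (fun p : RdN * RdN => (tnth p.1 k, tnth p.2 k)).
  by apply: measurable_fun_pair; apply: (measurableT_comp (measurable_tnth k)).
exact: (measurableT_comp (measurable_posterior (marginal k mu)) mk).
Qed.

Lemma integral_joint_posterior (j : 'I_N) (f : Rd -> R) (Y : RdN) :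
  measurable_fun setT f -> (forall x, 0 <= f x) ->
  (\int[P]_X (f (tnth X j) * joint_posterior Y X)%:E =
   \int[marginal j mu]_x (f x * posterior (marginal j mu) (tnth Y j) x)%:E)%E.
Proof.
move=> mf f0.
apply: (ge0_integral_tuple_product_marginal
  (m := fun k => marginal k mu)
  (g := fun k x => posterior (marginal k mu) (tnth Y k) x)) => //.
- by move=> k; exact: measurable_posteriorr.
- by move=> k x; exact: posterior_ge0.
- by move=> k; exact: integral_posterior.
Qed.

Lemma integral_joint_posterior1 (j : 'I_N) Y :
  (\int[P]_X (joint_posterior Y X)%:E = 1)%E.
Proof.
rewrite -(integral_posterior (marginal j mu) (tnth Y j)).
transitivity (\int[P]_X (cst 1%R (tnth X j) * joint_posterior Y X)%:E)%E.
  by apply: eq_integral => X _; rewrite mul1r.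
rewrite integral_joint_posterior//.
by apply: eq_integral => x _; rewrite mul1r.
Qed.

(** The inner integral depends on [Y] only through [y_j], so the outer one
reduces to the [j]-th marginal of [Lambda]; the law of total probability
concludes. *)
Lemma is_Theta_integral_marginal (nu : {measure set RdN -> \bar R}) (j : 'I_N)
    (f : Rd -> R) (C : R) :
  is_Theta eps mu nu -> Cb (fun X : RdN => f (tnth X j)) ->
  measurable_fun setT f -> (forall x, 0 <= f x <= C) ->
  (\int[nu]_X (f (tnth X j))%:E = \int[marginal j mu]_x (f x)%:E)%E.
Proof.
move=> nuT fCb mf fC; have f0 x : 0 <= f x by case/andP: (fC x).
rewrite (nuT _ fCb) -integral_posterior_gauss_conv//.
(* Real-valued, because [integral_Lambda_marginal] is about real functions. *)
pose F y := (\int[marginal j mu]_x (f x * posterior (marginal j mu) y x))%R.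
have mfp : measurable_fun setT
    (fun p : Rd * Rd => f p.2 * posterior (marginal j mu) p.1 p.2).
  apply: measurable_funM; last exact: measurable_posterior.
  exact: (measurableT_comp mf).
have FE y : (F y)%:E =
    (\int[marginal j mu]_x (f x * posterior (marginal j mu) y x)%:E)%E.
  apply: (@EFin_Rintegral_bounded _ _ _ _ _ (C * ((2 * pi * eps) `^
      (- (d%:R / 2)) / conv_density eps (marginal j mu) y))).
    exact: (measurableT_comp mfp (measurable_pair1 y)).
  move=> x; case/andP: (fC x) => _ fxC.
  rewrite mulr_ge0 ?posterior_ge0//=; apply: ler_pM => //.
    exact: posterior_ge0.
  by rewrite /posterior ler_wpM2r ?gauss_le// invr_ge0 conv_density_ge0.
transitivity (\int[Lambda eps mu]_Y (F (tnth Y j))%:E)%E.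
  by apply: eq_integral => Y _; rewrite FE; exact: integral_joint_posterior.
rewrite integral_Lambda_marginal//.
- by apply: eq_integral => y _; exact: FE.
- apply: (measurableT_comp (fine_measurable measurableT)).
  apply: (measurable_fun_fubini_tonelli_F (m2 := marginal j mu)
    (fun p => (f p.2 * posterior (marginal j mu) p.1 p.2)%:E)).
    exact/measurable_EFinP.
  by move=> p; rewrite lee_fin mulr_ge0 ?posterior_ge0.
- by move=> y; apply: Rintegral_ge0 => x _; rewrite mulr_ge0 ?posterior_ge0.
Qed.

(** The witness is the law of [X] under the measure on pairs [(Y, X)] with
density [joint_posterior] with respect to [Lambda] times the product of the
marginals. This pair measure has mass 1, so bounded functions are integrable
and Fubini applies to signed test functions. The index [j] is the coordinate
along which these masses are computed. *)
Lemma is_Theta_exists (j : 'I_N) :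
  exists nu : {measure set RdN -> \bar R}, is_Theta eps mu nu.
Proof.
pose L : probability RdN R := HB.pack (Lambda eps mu)
  (Measure_isProbability.Build _ _ _ (Lambda eps mu) (Lambda_setT heps mu j)).
pose K (p : RdN * RdN) := joint_posterior p.1 p.2.
pose m := (L \x P)%E.
have mK : measurable_fun setT K by exact: measurable_joint_posterior.
have K0 p : 0 <= K p by exact: joint_posterior_ge0.
pose w : {measure set (RdN * RdN) -> \bar R} := HB.pack (with_density m K)
  (isMeasure.Build _ _ _ (with_density m K) (with_density0 _ _)
    (with_density_ge0 _ K0) (with_density_sigma_additive mK K0)).
have wE A : measurable A -> w A = with_density m K A by [].
have mK' : measurable_fun setT (EFin \o K) by exact/measurable_EFinP.
have Kint : (\int[m]_p (K p)%:E = 1)%E.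
  rewrite (fubini_tonelli1 (EFin \o K))//.
  transitivity (\int[L]_Y (cst 1%E Y))%E.
    by apply: eq_integral => Y _; exact: integral_joint_posterior1.
  by rewrite integral_cst//= mul1e; exact: (Lambda_setT heps mu j).
have msnd : measurable_fun setT (snd : RdN * RdN -> RdN) by [].
pose nu : {measure set RdN -> \bar R} :=
  measure_function_pushforward__canonical__measure_function_Measure w msnd.
exists nu => psi [cpsi [C psiC]].
have mpsi := continuous_measurable_tuple cpsi.
have mpsi2 : measurable_fun setT (fun p : RdN * RdN => psi p.2).
  exact: (measurableT_comp mpsi).
(* The one bound behind both integrability side conditions below. *)
have psiK_lty : (\int[m]_p (`|(psi p.2)%:E| * (K p)%:E) < +oo)%E.
  apply: (@le_lt_trans _ _ (\int[m]_p (C%:E * (K p)%:E))%E).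
    apply: ge0_le_integral => //.
    - by move=> p _; rewrite mule_ge0 ?lee_fin.
    - apply: emeasurable_funM => //; apply: measurableT_comp => //.
      exact/measurable_EFinP.
    - exact: measurable_funeM.
    - by move=> p _; rewrite lee_wpmul2r ?lee_fin.
  rewrite ge0_integralZl ?Kint ?mule1 ?ltry//.
    by move=> p _; rewrite lee_fin.
  by rewrite lee_fin (le_trans _ (psiC point)).
rewrite integral_pushforward//; last 2 first.
- exact/measurable_EFinP.
- apply/integrableP; split; first exact/measurable_EFinP.
  rewrite preimage_setT (ge0_integral_density mK K0 wE)//.
  by apply: measurableT_comp => //; exact/measurable_EFinP.
rewrite preimage_setT (integral_density mK K0 wE); last exact/measurable_EFinP.
rewrite -(integral12_prod_meas1 (m1 := L) (m2 := P)
  (f := fun p => (psi p.2)%:E * (K p)%:E)%E)//.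
apply/integrableP; split.
  by apply: emeasurable_funM => //; exact/measurable_EFinP.
by under eq_integral do rewrite abseM [X in (_ * X)%E]gee0_abs ?lee_fin//.
Qed.

End Theta.

(** * Continuous test functions determine a finite measure *)

Section orthant.
Context (R : realType) (d : nat).
Local Notation Rd := (d.-tuple R).

Definition orthant (a : Rd) : set Rd := [set x | forall i, tnth a i < tnth x i].

Lemma orthantE a : orthant a =
  \bigcap_(i in [set: 'I_d]) [set x : Rd | tnth a i < tnth x i].
Proof.
apply/seteqP; split => x /= h i; first by move=> _; exact: h.
exact: (h i Logic.I).
Qed.

Lemma measurable_coord_gt (i : 'I_d) (r : R) :
  measurable [set x : Rd | r < tnth x i].
Proof.
have := @measurable_tnth _ R d i measurableT _ (measurable_itv `]r, +oo[).
rewrite setTI; congr measurable.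
by apply/seteqP; split => X /=; rewrite in_itv/= andbT.
Qed.

Lemma measurable_orthant a : measurable (orthant a).
Proof.
rewrite orthantE; apply: fin_bigcap_measurable => // i _.
exact: measurable_coord_gt.
Qed.

Lemma orthant_setI_closed : setI_closed (range orthant).
Proof.
move=> _ _ [a _ <-] [b _ <-].
exists [tuple Num.max (tnth a i) (tnth b i) | i < d] => //.
apply/seteqP; split => x /=.
  by move=> h; split => i; have := h i; rewrite tnth_mktuple gt_max => /andP[].
by move=> [ha hb] i; rewrite tnth_mktuple gt_max ha hb.
Qed.

Lemma exists_nat_lt_coord (x : Rd) :
  exists n : nat, forall i, - n%:R < tnth x i.
Proof.
have : \forall n \near \oo, forall i, - tnth x i < n%:R.
  by apply: filter_forall => i; exact: nbhs_infty_gtr.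
by move=> /filter_ex[n hn]; exists n => i; rewrite ltrNl.
Qed.

Lemma orthant_cover :
  \bigcup_n orthant [tuple - n%:R | _ < d] = setT.
Proof.
apply/seteqP; split => // x _; have [n hn] := exists_nat_lt_coord x.
by exists n => // i; rewrite tnth_mktuple.
Qed.

(** A coordinate half-space is the increasing union of the orthants whose other
lower bounds are [- n]. *)
Lemma measurable_orthantE : @measurable _ Rd = <<s range orthant >>.
Proof.
apply/seteqP; split; last first.
  apply: smallest_sub; first exact: sigma_algebra_measurable.
  by move=> _ [a _ <-]; exact: measurable_orthant.
apply: smallest_sub; first exact: smallest_sigma_algebra.
apply: (@big_ind _ (fun G : set (set Rd) => G `<=` <<s range orthant >>)) => //.
  by move=> G H hG hH; rewrite subUset.
move=> i _.
pose S : measurableType _ := g_sigma_algebraType (range orthant).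
have mi : measurable_fun [set: S] (fun x : S => tnth (x : Rd) i : R).
  apply: (measurability _ (RGenOInfty.measurableE R)).
  move=> _ [_ [r ->] <-]; rewrite setTI.
  rewrite (_ : _ @^-1` _ = \bigcup_n
     orthant [tuple if k == i then r else - n%:R | k < d]); last first.
    apply/seteqP; split => x /=; rewrite in_itv/= andbT.
      move=> rx; have [n hn] := exists_nat_lt_coord x; exists n => // k.
      by rewrite tnth_mktuple; case: eqP => // ->.
    by move=> [n _] /(_ i); rewrite tnth_mktuple eqxx.
  apply: bigcupT_measurable => n; apply: sub_sigma_algebra.
  by eexists.
by move=> _ [B mB <-]; exact: (mi measurableT B mB).
Qed.

(** Continuous functions increasing with [n] to the indicator of the orthant:
each factor is 0 up to [a_i], and climbs with slope [n] until it reaches 1. *)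
Definition ramp (n : nat) (a x : Rd) : R :=
  \prod_(i < d) Num.min 1 (Num.max 0 (n%:R * (tnth x i - tnth a i))).

Lemma ramp_ge0 n a x : 0 <= ramp n a x.
Proof. by apply: prodr_ge0 => i _; rewrite le_min ler01 le_max lexx. Qed.

Lemma ramp_le1 n a x : ramp n a x <= 1.
Proof.
apply: prodr_ile1 => i _.
by rewrite le_min ler01 le_max lexx ge_min lexx.
Qed.

Lemma ramp_nondecreasing a x : nondecreasing_seq (fun n => ramp n a x).
Proof.
move=> m n mn; apply: ler_prod => i _; rewrite le_min ler01 le_max lexx/=.
have [ax|xa] := leP 0 (tnth x i - tnth a i).
  by apply: le_min2 => //; apply: le_max2 => //; rewrite ler_wpM2r// ler_nat.
by rewrite !max_l ?min_r// nmulr_lle0// mulr_ge0_le0 ?ltW.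
Qed.

Lemma ramp_cvg a x : ramp n a x @[n --> \oo] --> (\1_(orthant a) x : R).
Proof.
have [ax|nax] := pselect (orthant a x).
  rewrite indicE mem_set//=; apply: cvg_near_cst.
  have : \forall n \near \oo, forall i, (tnth x i - tnth a i)^-1 <= n%:R.
    by apply: filter_forall => i; exact: nbhs_infty_ger.
  apply: filterS => n hn; rewrite /ramp big1// => i _; apply/min_l.
  by rewrite le_max -ler_pdivrMr ?subr_gt0// div1r hn orbT.
rewrite indicE memNset//=.
have [i xa] : exists i, tnth x i <= tnth a i.
  apply/not_existsP => h; apply: nax => i; rewrite ltNge; apply/negP; exact: h.
apply: cvg_near_cst; near=> n.
rewrite /ramp (bigD1 i)//= max_l ?min_r ?mul0r//.
by rewrite mulr_ge0_le0// subr_le0.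
Unshelve. all: by end_near. Qed.

Lemma measurable_ramp n a : measurable_fun setT (ramp n a).
Proof.
apply: measurable_prod => i _.
apply: measurable_minr => //; apply: measurable_maxr => //.
apply: measurable_funM => //; apply: measurable_funB => //.
exact: measurable_tnth.
Qed.

Lemma Cb_ramp N (j : 'I_N) n a :
  Cb (fun X : N.-tuple Rd => ramp n a (tnth X j)).
Proof.
split; last by exists 1 => X; rewrite ger0_norm ?ramp_ge0 ?ramp_le1.
rewrite (_ : _ \o _ = fun M : 'M[R]_(N, d) =>
    \prod_(i < d) Num.min 1 (Num.max 0 (n%:R * (M j i - tnth a i))));
  last first.
  by apply/funext => M /=; apply: eq_bigr => i _; rewrite !tnth_mktuple.
apply: continuous_big => [|i _ M].
  exact: mul_continuous.
pose g (M : 'M[R]_(N, d)) : R := n%:R * (M j i - tnth a i).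
have cg : {for M, continuous g}.
  apply: (@continuousM _ _ (fun=> n%:R)
    (fun M : 'M[R]_(N, d) => M j i - tnth a i)); first exact: cst_continuous.
  apply: (@continuousB _ R^o _ (fun M : 'M[R]_(N, d) => M j i)).
    exact: coord_continuous.
  exact: cst_continuous.
suff : {for M, continuous ((fun=> 1) \min ((fun=> 0) \max g))} by [].
apply: continuous_min; first exact: cst_continuous.
by apply: continuous_max; first exact: cst_continuous.
Qed.

(** Monotone convergence along the ramps gives equality on orthants, and these
form a generating pi-system covering the space. *)
Lemma finite_measure_eq_ramp (m1 m2 : {measure set Rd -> \bar R}) :
  (forall n a, \int[m1]_x (ramp n a x)%:E = \int[m2]_x (ramp n a x)%:E)%E ->
  (m2 setT < +oo)%E ->
  forall A, measurable A -> m1 A = m2 A.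
Proof.
move=> m12 m2oo A mA.
have E a : m1 (orthant a) = m2 (orthant a).
  have I (m : {measure set Rd -> \bar R}) : m (orthant a) =
      limn (fun n => \int[m]_x (ramp n a x)%:E)%E.
    rewrite -monotone_convergence//.
    - transitivity (\int[m]_x (\1_(orthant a) x)%:E)%E.
        by rewrite integral_indic ?setIT//; exact: measurable_orthant.
      apply: eq_integral => x _; apply/esym/cvg_lim => //.
      by apply: cvg_EFin; [exact: nearW|exact: ramp_cvg].
    - by move=> n; apply/measurable_EFinP; exact: measurable_ramp.
    - by move=> n x _; rewrite lee_fin ramp_ge0.
    - by move=> x _ m' n mn; rewrite lee_fin ramp_nondecreasing.
  by rewrite !I; congr (limn _); apply/funext => n; exact: m12.
apply/esym.
apply: (measure_unique (range orthant)
  (fun n => orthant [tuple - n%:R | _ < d])) => //.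
- exact: measurable_orthantE.
- exact: orthant_setI_closed.
- exact: orthant_cover.
- by move=> _ [a _ <-].
- move=> n; apply: le_lt_trans m2oo; apply: le_measure; rewrite ?inE//.
  exact: measurable_orthant.
Qed.

End orthant.

(** * Marginals of Lambda and of Theta *)

Theorem lemma5p2 (R : realType) (d N : nat) (hd : (0 < d)%N) (hN : (0 < N)%N)
    (mu : probability (N.-tuple (d.-tuple R)) R) (eps : R) (heps : 0 < eps)
    (j : 'I_N) :
  (forall A : set (d.-tuple R), measurable A ->
     marginal j (Lambda eps mu) A = gauss_conv eps (marginal j mu) A) /\
  (forall A : set (d.-tuple R), measurable A ->
     marginal j (Theta eps mu) A = marginal j mu A).
Proof.
split=> A mA; first exact: marginal_Lambda.
have TT : is_Theta eps mu (Theta eps mu).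
  rewrite /Theta; case: pselect => [ex|noex]; first by case: (cid ex).
  by have := noex (is_Theta_exists heps mu j).
apply: (finite_measure_eq_ramp (m1 := marginal j (Theta eps mu))
  (m2 := marginal j mu)) => // [n a|].
  have mr : measurable_fun setT (EFin \o ramp n a).
    by apply/measurable_EFinP; exact: measurable_ramp.
  rewrite integral_marginal//; last by move=> x; rewrite lee_fin ramp_ge0.
  apply: (is_Theta_integral_marginal (C := 1) heps TT) => //.
  - exact: Cb_ramp.
  - exact: measurable_ramp.
  - by move=> x; rewrite ramp_ge0 ramp_le1.
by rewrite (_ : _ setT = 1%E) ?ltry//; exact: probability_setT.
Qed.
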